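(* Let $\alpha(n)=2^{-n^{1/4}\sqrt{\log n}/64}$ and $\beta(n)=n^{-3/4}\sqrt{\log n}/128$, and write $\alpha=\alpha(n)$, $\beta=\beta(n)$. For all sufficiently large $n\in\mathbb{N}$, $$\Pr_{M_n}\left[\overline{\mathrm{Orth}_{\alpha,\beta n}(n)}\right]\leq 2^{-n/32},$$ where $\mathrm{Orth}_{\alpha,\beta n}(n)$ is the event that every non-zero vector $\boldsymbol{a}\in\mathbb{Z}^n$ which is orthogonal to at least $(1-\beta)n$ rows of $M_n$ satisfies $\rho^{\mathbb{Z}}_{\mu}(\boldsymbol{a})\leq\alpha$ for all $0\leq\mu\leq 1/2$, and the overline denotes the complementary event.
   Context: $M_n$ is a random symmetric $n\times n$ matrix whose entries on and above the diagonal are i.i.d., taking values $\pm1$ with probability $1/2$ each. $\log$ is the natural logarithm. Atom probability: for a ring $\mathfrak{R}$ with unit, a vector $\boldsymbol{a}=(a_1,\dots,a_n)\in\mathfrak{R}^n$ and $\mu\in[0,1]$, $$\rho^{\mathfrak{R}}_{\mu}(\boldsymbol{a}):=\sup_{c\in\mathfrak{R}}\Pr\left[a_1x_1^{\mu}+\dots+a_nx_n^{\mu}=c\right],$$ where the $x_i^{\mu}$ are i.i.d. random variables taking the value $0$ with probability $\mu$ and the values $\pm1$ with probability $(1-\mu)/2$ each. Here $\mathfrak{R}=\mathbb{Z}$. *)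

(* Defs.v *)
From mathcomp Require Import all_boot all_order all_algebra.
From mathcomp Require Import boolp classical_sets reals exp.

Set Implicit Arguments.
Unset Strict Implicit.
Unset Printing Implicit Defensive.

Import Order.TTheory GRing.Theory Num.Theory.

Local Open Scope classical_set_scope.
Local Open Scope ring_scope.

(* [iid_prob p E] is the probability of [E] under the product law that makes
   the coordinates [w i] independent, each with mass function [p].  Only used
   with [p] nonnegative and summing to 1. *)
Definition iid_prob (R : realType) (I T : finType) (p : T -> R)
    (E : set {ffun I -> T}) : R :=
  \sum_(w : {ffun I -> T} | w \in E) \prod_(i : I) p (w i).

(* [None] encodes the value 0 and [Some b] the value (-1)^b. *)
Definition lazy_mass (R : realType) (mu : R) (s : option bool) : R :=
  if s is Some _ then (1 - mu) / 2 else mu.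

Definition lazy_value (A : pzRingType) (s : option bool) : A :=
  if s is Some b then (-1) ^+ b else 0.

Definition atom_prob (R : realType) (A : pzRingType) (n : nat) (mu : R)
    (a : 'rV[A]_n) : R :=
  sup (range (fun c : A =>
    iid_prob (lazy_mass mu)
      [set w : {ffun 'I_n -> option bool} |
        \sum_(i < n) a 0 i * lazy_value A (w i) = c])).

Notation upper_index n :=
  {ij : 'I_n * 'I_n | (nat_of_ord ij.1 <= nat_of_ord ij.2)%N}.

Fact upper_index_subproof (n : nat) (i j : 'I_n) :
  ((Order.min i j, Order.max i j).1 <= (Order.min i j, Order.max i j).2)%N.
Proof. by rewrite /=; case: leP => // /ltW. Qed.

Definition to_upper (n : nat) (i j : 'I_n) : upper_index n :=
  exist _ (Order.min i j, Order.max i j) (upper_index_subproof i j).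

Definition sym_sign_mx (n : nat) (w : {ffun upper_index n -> bool}) :
    'M[int]_n :=
  \matrix_(i, j) (-1) ^+ w (to_upper i j).

Definition prob_sym_sign_mx (R : realType) (n : nat) (E : set 'M[int]_n) : R :=
  iid_prob (fun _ : bool => 2^-1 : R) (@sym_sign_mx n @^-1` E).

Definition Orth (R : realType) (n : nat) (alpha beta : R) : set 'M[int]_n :=
  [set M | forall a : 'rV[int]_n, a != 0 ->
    (1 - beta) * n%:R <= #|[pred i : 'I_n | row i M *m a^T == 0]|%:R ->
    forall mu : R, 0 <= mu <= 1 / 2 -> atom_prob mu a <= alpha].

Arguments Orth {R} n alpha beta.

Definition alpha_ (R : realType) (n : nat) : R :=
  2 `^ (- (n%:R `^ (1 / 4) * Num.sqrt (ln n%:R) / 64)).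

Definition beta_ (R : realType) (n : nat) : R :=
  n%:R `^ (- (3 / 4)) * Num.sqrt (ln n%:R) / 128.

(* Main.v *)
Require Import Defs.
From mathcomp Require Import all_boot all_order all_algebra.
From mathcomp Require Import boolp classical_sets reals exp.
From mathcomp Require Import complex ring lra zify.

(* Let [p] be a prime with [log p] of order [n ^ (1/3)].  A non-zero integer
   vector orthogonal to almost all rows may be taken non-zero modulo [p].  For
   [u] in [F_p ^ n] and a set [B] of coordinates, let [ret u B] be the return
   probability of a very lazy random walk with steps [2 u_j], [j] in [B]; by
   Fourier inversion it dominates the atom probabilities of [(u_j)_(j in B)], and
   the rows of [M_n] in a set [S] disjoint from [B] all annihilate [u] with
   probability at most [ret u B ^ #|S|].
   Choose [B] maximal such that [ret u B <= (255/256) ^ #|B|].  Since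
   [ret u B >= 1/p], its size is O(log p), and by maximality the walk returns to 0
   hardly more often than it visits [2 u_i], for every [i] outside [B].  The set
   [L] of all [x] with that property in place of [u_i] depends only on the
   restriction of [u] to [B], and [#|L| * ret u B <= 7/8]: indeed [L + L] is
   contained in a similar set with weaker constant, of size at most
   [64 / (49 ret u B)], and [#|L + L| >= 3/2 #|L|] unless [L + L] is a subgroup
   of [F_p].  Hence the union bound over [S], [B], the restriction of [u] to [B]
   (at most [p ^ #|B|] choices) and the remaining coordinates of [u] (at most
   [#|L|] choices each) gives [(7/8) ^ n] times [2 ^ O(log(p) ^ 2)]. *)

Set Implicit Arguments.
Unset Strict Implicit.
Unset Printing Implicit Defensive.

Import Order.TTheory GRing.Theory Num.Theory.

(** * Primes between [2 ^ j] and [2 ^ (2 j + 1)] *)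

Lemma central_bin_ge n : 2 ^ n <= 'C(n.*2, n).
Proof.
elim: n => [|n IH]; first by rewrite bin0.
rewrite doubleS binS expnS mul2n -addnn leq_add //.
  by rewrite binS (leq_trans IH) // leq_addl.
by rewrite (leq_trans IH) // leq_bin2l.
Qed.

(** By Legendre's formula the exponent is the sum over [k] of [n.*2 %/ q ^ k - 2 * (n %/ q ^ k)];
    each term is at most 1 and vanishes once [q ^ k > n.*2]. *)
Lemma pfactor_central_bin_le q n : prime q -> 0 < n ->
  q ^ logn q 'C(n.*2, n) <= n.*2.
Proof.
move=> q_prime n0; have q1 := prime_gt1 q_prime.
have n20 : 0 < n.*2 by rewrite double_gt0.
apply: leq_trans (_ : q ^ trunc_log q n.*2 <= _); last by rewrite trunc_logP.
rewrite leq_exp2l //; set t := trunc_log q n.*2.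
have le_n : n <= n.*2 by rewrite -addnn leq_addl.
have := congr1 (logn q) (bin_fact le_n).
rewrite -{2}addnn addnK !lognM ?muln_gt0 ?fact_gt0 ?bin_gt0 // !logn_fact //.
have -> : \sum_(1 <= k < n.+1) n %/ q ^ k = \sum_(1 <= k < n.*2.+1) n %/ q ^ k.
  rewrite [RHS](@big_cat_nat _ _ _ n.+1) //= [X in _ = _ + X]big_nat_cond.
  rewrite [X in _ = _ + X]big1 ?addn0 // => k /andP[/andP[nk _] _].
  by rewrite divn_small // (leq_trans nk) // ltnW // ltn_expl.
have -> : t = \sum_(1 <= k < n.*2.+1) (k <= t).
  have sumE m : \sum_(1 <= k < m.+1) (k <= t) = minn m t.
    elim: m => [|m IH]; first by rewrite big_geq ?min0n.
    by rewrite big_nat_recr //= IH; lia.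
  rewrite sumE; apply/esym/minn_idPr; rewrite /t.
  have := trunc_logP q1 n20; apply: leq_trans.
  by rewrite ltnW // ltn_expl.
set S2 := \sum_(1 <= k < _) n.*2 %/ _; set S1 := \sum_(1 <= k < _) n %/ _.
set St := \sum_(1 <= k < _) (k <= t).
suff : S2 <= St + (S1 + S1) by lia.
rewrite -!big_split /=; apply: leq_sum => k _.
have [kt|tk] := leqP k t; last first.
  by rewrite divn_small // (leq_trans (trunc_log_ltn n.*2 q1)) // leq_exp2l.
have d0 : 0 < q ^ k by rewrite expn_gt0 ltnW.
rewrite -ltnS ltn_divLR //=.
have := ltn_ceil n d0; rewrite -addnn; set d := q ^ k; set x := n %/ d.
rewrite mulSn => h; rewrite (_ : (1 + (x + x)).+1 = x.+1 + x.+1) ?mulnDl; last by lia.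
by rewrite mulSn; lia.
Qed.

(* If no prime in that range existed, then with [N = 4 ^ j] every prime power
   dividing [C(2 N, N)] would be at most [2 N] and come from a prime at most
   [2 ^ j], so that [2 ^ N <= C(2 N, N) <= (2 N) ^ (2 ^ j)]. *)
Lemma prime_between j : 2 < j ->
  exists2 q, prime q & 2 ^ j < q <= 2 ^ (j.*2.+1).
Proof.
move=> j2; pose N := 2 ^ j.*2; pose C := 'C(N.*2, N).
have N0 : 0 < N by rewrite expn_gt0.
have N2 : N.*2 = 2 ^ j.*2.+1 by rewrite expnS mul2n.
have C0 : 0 < C by rewrite bin_gt0 -addnn leq_addl.
have leq q : q \in primes C -> q <= N.*2.
  move=> qC; have q_prime : prime q by move: qC; rewrite mem_primes => /and3P[].
  have := pfactor_central_bin_le q_prime N0; apply: leq_trans.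
  by rewrite -{1}(expn1 q) leq_exp2l ?prime_gt1 // logn_gt0.
have [/hasP[q qC qj]|/hasPn small] := boolP (has (fun q => 2 ^ j < q) (primes C)).
  exists q; first by move: qC; rewrite mem_primes => /and3P[].
  by rewrite qj -N2 leq.
have sizeC : size (primes C) <= 2 ^ j.
  rewrite -(size_iota 1 (2 ^ j)); apply: uniq_leq_size (primes_uniq C) _ => q qC.
  rewrite mem_iota add1n ltnS [q <= _]leqNgt small // andbT.
  by move: qC; rewrite mem_primes => /andP[/prime_gt0].
have : C <= N.*2 ^ (2 ^ j).
  rewrite [X in X <= _](prod_prime_decomp C0) prime_decompE big_map /=.
  apply: leq_trans (_ : N.*2 ^ size (primes C) <= _); last first.
    by rewrite leq_exp2l // N2 -{1}(expn0 2) ltn_exp2l.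
  have : {subset primes C <= primes C} by [].
  elim: {1 3 4}(primes C) => [|q s IH] sC; first by rewrite big_nil.
  rewrite big_cons expnS leq_mul ?IH // => [|x xs]; last by rewrite sC ?inE ?xs ?orbT.
  have := sC q (mem_head _ _); rewrite mem_primes => /and3P[q_prime _ _].
  exact: pfactor_central_bin_le.
rewrite leqNgt (leq_trans _ (central_bin_ge N)) //.
(* Comparing exponents leaves [2 j + 1 < 2 ^ j], true from [j = 3] on. *)
rewrite N2 -expnM ltn_exp2l // /N -addnn expnD ltn_mul2r expn_gt0 /=.
elim: j j2 {N C N0 N2 C0 leq small sizeC} => // -[|[|[|j]]] // IH _.
by rewrite expnS; lia.
Qed.

Local Open Scope ring_scope.
Local Open Scope complex_scope.

(** * Sums and probabilities over finite types *)

(** A set of at most [k] elements is recovered from its enumeration, padded with [None] to length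
    [k]. *)
Lemma card_small_sets (T : finType) k :
  (#|[set A : {set T} | #|A| <= k]| <= (#|T|.+1) ^ k)%N.
Proof.
rewrite -card_option -[X in (_ <= _ ^ X)%N](card_ord k) -card_ffun.
pose h (f : {ffun 'I_k -> option T}) : {set T} :=
  [set x | [exists i, f i == Some x]]%SET.
apply: leq_trans (leq_imset_card h {: {ffun 'I_k -> option T}}).
apply/subset_leq_card/fintype.subsetP => A; rewrite inE => Ak.
apply/imsetP; exists [ffun i : 'I_k => nth None (map Some (enum A)) i] => //.
apply/setP => x; rewrite inE; apply/idP/existsP => [xA|]; last case=> i.
  have ix : (index x (enum A) < size (enum A))%N by rewrite index_mem mem_enum.
  have ik : (index x (enum A) < k)%N by apply: leq_trans ix _; rewrite -cardE.
  by exists (Ordinal ik); rewrite ffunE (nth_map x) //= nth_index // mem_enum.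
rewrite ffunE => /eqP e.
have [il|il] := ltnP i (size (map Some (enum A))).
  have := mem_nth None il; rewrite e => /mapP[y yA [xy]].
  by rewrite xy -mem_enum.
by move: e; rewrite nth_default.
Qed.

(* For every [d] in [T + T] more than half of the [t] in [T] satisfy
   [t + d \in T], so two such translates of [T] always meet. *)
Lemma small_doubling_addr_closed (G : finZmodType) (T : {set G}) :
    {in T, forall x, - x \in T} ->
  let S := [set x + y | x in T, y in T]%SET in
  (2 * #|S| < 3 * #|T|)%N -> {in S &, forall x y, x + y \in S}.
Proof.
move=> TN S small.
pose U d := [set t in T | t + d \in T]%SET.
have Ubig d : d \in S -> (#|T| < 2 * #|U d|)%N.
  case/imset2P => a b aT bT ->.
  pose T' := [set t - (a + b) | t in T]%SET.
  have cT' : #|T'| = #|T| by rewrite card_imset //; apply: addIr.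
  have sub : ([set a + t | t in T :|: T'] \subset S)%SET.
    apply/fintype.subsetP => _ /imsetP[t + ->]; rewrite inE => /orP[tT|].
      by rewrite imset2_f.
    case/imsetP => t' t'T ->.
    rewrite (_ : a + (t' - (a + b)) = t' + - b) ?imset2_f ?TN //.
    by rewrite opprD addrCA addNKr.
  have := subset_leq_card sub; rewrite card_imset; last exact: addrI.
  have -> : U (a + b) = (T :&: T')%SET.
    apply/setP => t; rewrite !inE; congr (_ && _).
    apply/idP/imsetP => [h|[t' t'T ->]]; last by rewrite subrK.
    by exists (t + (a + b)); rewrite ?addrK.
  rewrite cardsU cT' => le_S.
  have arith (t i u : nat) :
      (2 * u < 3 * t -> t + t - i <= u -> i <= t -> t < 2 * i)%N by lia.
  exact: arith small le_S (subset_leq_card (subsetIl T T')).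
have SN d : d \in S -> - d \in S.
  by case/imset2P => a b aT bT ->; rewrite opprD imset2_f ?TN.
move=> d1 d2 d1S d2S.
have h1 := Ubig _ (SN _ d1S); have h2 := Ubig _ d2S.
have : (0 < #|U (- d1) :&: U d2|)%N.
  have eqUI := cardsUI (U (- d1)) (U d2).
  have leT : (#|U (- d1) :|: U d2| <= #|T|)%N.
    by apply/subset_leq_card/fintype.subsetP => x; rewrite !inE => /orP[]/andP[].
  have arith (t a b u i : nat) :
      (t < 2 * a -> t < 2 * b -> u + i = a + b -> u <= t -> 0 < i)%N by lia.
  exact: arith h1 h2 eqUI leT.
case/card_gt0P => t; rewrite !inE => /andP[/andP[_ h3] /andP[_ h4]].
rewrite (_ : d1 + d2 = (t + d2) + - (t - d1)) ?imset2_f ?TN //.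
by rewrite opprB addrAC addrCA subrr addr0 addrC.
Qed.

(** The multiples of a non-zero [d] exhaust ['F_p]: [x] is [x / d] times [d]. *)
Lemma addr_closed_Fp (p : nat) (S : {set 'F_p}) : prime p ->
  {in S &, forall x y, x + y \in S} -> 0 \in S -> S = [set 0] \/ S = [set: 'F_p].
Proof.
move=> p_prime SD S0.
have [/exists_inP[d dS d0]|] := boolP [exists d in S, d != 0].
  right; apply/setP => x; rewrite inE.
  have mulS k : d *+ k \in S by elim: k => [|k IH]; rewrite ?mulr0n // mulrS SD.
  by rewrite -[x](divfK d0) -[x / d]natr_Zp mulr_natl mulS.
rewrite negb_exists_in => /forall_inP h; left; apply/setP => x; rewrite inE.
by apply/idP/eqP => [/h /negPn/eqP //|->].
Qed.

Lemma doubling_Fp (p : nat) (T : {set 'F_p}) : prime p ->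
    {in T, forall x, - x \in T} -> 0 \in T ->
  let S := [set x + y | x in T, y in T]%SET in
  [\/ T = [set 0], S = [set: 'F_p] | (3 * #|T| <= 2 * #|S|)%N].
Proof.
move=> p_prime TN T0 S.
have [|small] := leqP (3 * #|T|) (2 * #|S|); first by constructor 3.
have TS : T \subset S.
  by apply/fintype.subsetP => x xT; rewrite -[x]addr0 imset2_f.
have SD := small_doubling_addr_closed TN small.
have [S0|] := addr_closed_Fp p_prime SD (fintype.subsetP TS _ T0); last first.
  by constructor 2.
constructor 1; apply/setP => x; rewrite inE; apply/idP/eqP => [xT|-> //].
by have := fintype.subsetP TS _ xT; rewrite [S]S0 inE => /eqP.
Qed.

Lemma le_iid_prob (R : realType) (I T : finType) (q : T -> R)
    (E E' : set {ffun I -> T}) :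
  (forall s, 0 <= q s) -> (E `<=` E')%classic -> iid_prob q E <= iid_prob q E'.
Proof.
move=> q0 EE'; rewrite /iid_prob [X in X <= _]big_mkcond [X in _ <= X]big_mkcond.
apply: ler_sum => w _ /=.
have P0 : 0 <= \prod_i q (w i) by apply: prodr_ge0.
case: ifPn => [|_]; last by case: ifP.
by rewrite inE => /EE' wE'; rewrite ifT // inE.
Qed.

Lemma to_upper_eq n (i j i' j' : 'I_n) : to_upper i j = to_upper i' j' ->
  (i = i' /\ j = j') \/ (i = j' /\ j = i').
Proof.
move=> /(congr1 val) /= [].
by case: (leP i j) => ?; case: (leP i' j') => ? ? ?; [left|right|right|left].
Qed.

Lemma iid_prob_union_bound (R : realType) (I T X : finType) (q : T -> R)
    (P : pred X) (E : set {ffun I -> T}) (F : X -> set {ffun I -> T}) :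
  (forall s, 0 <= q s) -> (forall w, E w -> exists2 x, P x & F x w) ->
  iid_prob q E <= \sum_(x | P x) iid_prob q (F x).
Proof.
move=> q0 EF; rewrite /iid_prob.
under [X in _ <= X]eq_bigr do rewrite big_mkcond /=.
rewrite exchange_big /= [X in X <= _]big_mkcond /=.
apply: ler_sum => w _.
have w0 : 0 <= \prod_i q (w i) by apply: prodr_ge0.
have s0 (Q : pred X) : 0 <= \sum_(x | Q x) (if w \in F x then \prod_i q (w i) else 0).
  by apply: sumr_ge0 => x _; case: ifP.
case: ifPn => [|_]; last exact: s0.
rewrite inE => /EF[x Px Fx]; rewrite (bigD1 x) //= ifT ?inE // lerDl.
exact: s0.
Qed.

(** * Fourier analysis on ['F_p] *)

Section Fourier.
Variables (R : realType) (p : nat).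
Hypothesis p_prime : prime p.

(** Take a root of [1 + X + ... + X ^ (p - 1)]: the geometric sum gives [z ^ p = 1], while the value
    at 1 is [p], not 0. *)
Lemma nontrivial_root_exists : exists2 z : R[i], z ^+ p = 1 & z != 1.
Proof.
pose q : {poly R[i]} := \sum_(i < p) 'X^i.
have qE (x : R[i]) : q.[x] = \sum_(i < p) x ^+ i.
  by rewrite horner_sum; apply: eq_bigr => i _; rewrite hornerXn.
have p_gt1 := prime_gt1 p_prime.
have q1 : q`_1 = 1.
  rewrite coef_sum (bigD1 (Ordinal p_gt1)) //= coefXn eqxx big1 ?addr0 // => i.
  by rewrite coefXn eq_sym -val_eqE /= => /negPf ->.
have sq : size q != 1.
  apply/eqP => s1; move: q1; rewrite nth_default ?s1 // => /eqP.
  by rewrite eq_sym oner_eq0.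
have /closed_rootP[z /rootP z0] := sq.
exists z.
  by apply/eqP; rewrite -subr_eq0 subrX1 -qE z0 mulr0.
apply/eqP => z1; move: z0; rewrite qE z1.
under eq_bigr do rewrite expr1n.
by rewrite sumr_const card_ord => /eqP; rewrite pnatr_eq0 -leqn0 leqNgt prime_gt0.
Qed.

Definition zeta : R[i] := projT1 (cid2 nontrivial_root_exists).

Lemma zetaXp : zeta ^+ p = 1.
Proof. by rewrite /zeta; case: cid2. Qed.

Lemma zeta_neq1 : zeta != 1.
Proof. by rewrite /zeta; case: cid2. Qed.

Definition chi (x : 'F_p) : R[i] := zeta ^+ x.

Lemma chi_nat n : chi n%:R = zeta ^+ n.
Proof.
by rewrite /chi -[in RHS](expr_mod n zetaXp) val_Fp_nat.
Qed.

Lemma chi0 : chi 0 = 1.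
Proof. by rewrite -[0]/(0%:R) chi_nat. Qed.

Lemma chiD x y : chi (x + y) = chi x * chi y.
Proof.
by rewrite -[x]natr_Zp -[y]natr_Zp -natrD !chi_nat exprD.
Qed.

Lemma chi_sum (I : finType) (f : I -> 'F_p) :
  chi (\sum_i f i) = \prod_i chi (f i).
Proof. exact: (big_morph chi chiD chi0). Qed.

Lemma norm_chi x : `|chi x| = 1.
Proof.
have : `|zeta| ^+ p == 1 by rewrite -normrX zetaXp normr1.
rewrite pexpr_eq1 ?prime_gt0 ?normr_ge0 // => /eqP n1.
by rewrite /chi normrX n1 expr1n.
Qed.

Lemma chiN x : chi (- x) = conjc (chi x).
Proof.
have h : chi x * chi (- x) = 1 by rewrite -chiD subrr chi0.
have h2 : chi x * conjc (chi x) = 1.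
  by have := sqr_normc (chi x); rewrite norm_chi expr1n => <-.
have nz : chi x != 0 by rewrite -normr_eq0 norm_chi oner_eq0.
by apply: (mulfI nz); rewrite h h2.
Qed.

(** For [x != 0] this is the sum of all values of [chi]; shifting the variable by 1 multiplies it by
    [zeta != 1], so it is 0. *)
Lemma sum_chi x : \sum_(xi : 'F_p) chi (xi * x) = (p * (x == 0))%:R.
Proof.
have [->|x0] := eqVneq x 0.
  under eq_bigr do rewrite mulr0 chi0.
  by rewrite sumr_const card_Fp // muln1.
rewrite muln0; have -> : \sum_xi chi (xi * x) = \sum_y chi y.
  by rewrite [RHS](reindex_inj (mulIf x0)).
apply/eqP; have := zeta_neq1; rewrite -subr_eq0 => nz.
rewrite -(mulrI_eq0 _ (mulfI nz)) mulrBl mul1r mulr_sumr.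
rewrite [X in _ - X](reindex_inj (addrI 1)) /= subr_eq0; apply/eqP.
by apply: eq_bigr => y _; rewrite chiD -[1]/(1%:R) chi_nat expr1.
Qed.

Definition cosp (x : 'F_p) : R := complex.Re (chi x).

Lemma ReD (x y : R[i]) : complex.Re (x + y) = complex.Re x + complex.Re y.
Proof. by case: x; case: y. Qed.

Lemma Re_sum (I : finType) (f : I -> R[i]) :
  complex.Re (\sum_i f i) = \sum_i complex.Re (f i).
Proof. exact: (big_morph (@complex.Re R) ReD (erefl _)). Qed.

Lemma cosp0 : cosp 0 = 1.
Proof. by rewrite /cosp chi0. Qed.

Lemma cospN x : cosp (- x) = cosp x.
Proof. by rewrite /cosp chiN; case: (chi x). Qed.

Lemma chi_sqr x : complex.Re (chi x) ^+ 2 + complex.Im (chi x) ^+ 2 = 1.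
Proof.
by apply: complexI; rewrite add_Re2_Im2 norm_chi expr1n.
Qed.

Lemma cosp_le1 x : cosp x <= 1.
Proof.
rewrite /cosp; have := chi_sqr x; have := sqr_ge0 (complex.Im (chi x)).
set c := complex.Re _; set s := complex.Im _; nra.
Qed.

Lemma cosp_geN1 x : -1 <= cosp x.
Proof.
rewrite /cosp; have := chi_sqr x; have := sqr_ge0 (complex.Im (chi x)).
set c := complex.Re _; set s := complex.Im _; nra.
Qed.

Lemma cosp_double x : cosp (x + x) = 2 * cosp x ^+ 2 - 1.
Proof.
rewrite /cosp chiD; have := chi_sqr x.
by case: (chi x) => c s /=; nra.
Qed.

Lemma chi_add_chiN x : chi x + chi (- x) = (2 * cosp x)%:C.
Proof. by rewrite chiN addcJ rmorphM /= rmorph_nat. Qed.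

(* Up to a factor 2, [1 - cosp x] is the squared distance from [chi x] to 1. *)
Lemma cospD_ge x y : 1 - cosp (x + y) <= 2 * (1 - cosp x) + 2 * (1 - cosp y).
Proof.
rewrite /cosp chiD; have := chi_sqr x; have := chi_sqr y.
case: (chi x) => c s; case: (chi y) => d t /= h1 h2.
have := sqr_ge0 (c + d - 2); have := sqr_ge0 (t - s); nra.
Qed.

Local Open Scope classical_set_scope.

Let p_neq0 : p%:R != 0 :> R[i].
Proof. by rewrite pnatr_eq0 -lt0n prime_gt0. Qed.

Lemma indicator_chi (x : 'F_p) :
  (x == 0)%:R = p%:R^-1 * \sum_(xi : 'F_p) chi (xi * x).
Proof. by rewrite sum_chi natrM mulrA mulVf ?mul1r. Qed.

Lemma indicator_chi_family (J : finType) (x : J -> 'F_p) :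
  [forall j, x j == 0]%:R =
  p%:R^-1 ^+ #|J| * \sum_(xi : {ffun J -> 'F_p}) chi (\sum_j xi j * x j).
Proof.
have -> : [forall j, x j == 0]%:R = \prod_j (x j == 0)%:R :> R[i].
  have [/forallP h|] := boolP [forall j, x j == 0].
    by rewrite big1 // => j _; rewrite h.
  rewrite negb_forall => /existsP[j /negPf xj].
  by rewrite (bigD1 j) //= xj mul0r.
under eq_bigr do rewrite indicator_chi.
rewrite big_split /= prodr_const bigA_distr_bigA /=; congr (_ * _).
by apply: eq_bigr => xi _; rewrite chi_sum.
Qed.

(** Fourier inversion in every equation turns the probability into an average over frequency vectors
    [xi]. By independence each term is a phase times a product of characteristic functions at
    [\sum_j xi j * c j i], whose moduli [phi] bounds. *)
Lemma prob_solutions_le (I T J : finType) (q : T -> R) (v : T -> 'F_p)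
    (phi : 'F_p -> R) (c : J -> I -> 'F_p) (t : J -> 'F_p) :
  (forall y, `|\sum_s (q s)%:C * chi (y * v s)| <= (phi y)%:C) ->
  iid_prob q
    [set w : {ffun I -> T} | forall j, \sum_i c j i * v (w i) = t j]
  <= p%:R^-1 ^+ #|J| *
     \sum_(xi : {ffun J -> 'F_p}) \prod_i phi (\sum_j xi j * c j i).
Proof.
move=> phiP; rewrite -lecR; set L := iid_prob _ _.
have LE : L%:C =
  p%:R^-1 ^+ #|J| * \sum_(xi : {ffun J -> 'F_p})
    chi (- \sum_j xi j * t j) *
    \prod_i \sum_s (q s)%:C * chi ((\sum_j xi j * c j i) * v s).
  rewrite /L /iid_prob rmorph_sum /= big_mkcond /=.
  transitivity (\sum_(w : {ffun I -> T}) p%:R^-1 ^+ #|J| *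
    \sum_(xi : {ffun J -> 'F_p}) chi (- \sum_j xi j * t j) *
       \prod_i ((q (w i))%:C * chi ((\sum_j xi j * c j i) * v (w i)))).
    apply: eq_bigr => w _.
    have -> : (w \in [set w : {ffun I -> T} | forall j, \sum_i c j i * v (w i) = t j]) =
              [forall j, \sum_i c j i * v (w i) - t j == 0].
      apply/idP/forallP => [|h].
        by rewrite inE /= => h j; rewrite h subrr.
      by rewrite inE /= => j; apply/eqP; rewrite -subr_eq0.
    transitivity ((\prod_i q (w i))%:C *
        [forall j, \sum_i c j i * v (w i) - t j == 0]%:R).
      by case: ifP => _; rewrite ?mulr1 ?mulr0.
    rewrite indicator_chi_family mulrCA mulr_sumr; congr (_ * _).
    apply: eq_bigr => xi _; rewrite big_split /= mulrCA -rmorph_prod.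
    congr (_ * _); rewrite -chi_sum -chiD; congr chi.
    under [LHS]eq_bigr do rewrite mulrBr mulr_sumr.
    rewrite big_split /= sumrN addrC; congr (_ + _).
    rewrite exchange_big /=; apply: eq_bigr => i _.
    by rewrite mulr_suml; apply: eq_bigr => j _; rewrite mulrA.
  rewrite -mulr_sumr exchange_big /=; congr (_ * _); apply: eq_bigr => xi _.
  by rewrite -mulr_sumr bigA_distr_bigA.
move: L LE => L LE.
rewrite LE rmorphM rmorph_sum rmorphXn /= fmorphV rmorph_nat -LE.
apply: le_trans (real_ler_norm _) _.
  by apply/complex_realP; exists L.
rewrite LE normrM normrX normfV normr_nat ler_wpM2l ?exprn_ge0 ?invr_ge0 //.
apply: le_trans (ler_norm_sum _ _ _) _; apply: ler_sum => xi _.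
rewrite normrM norm_chi mul1r normr_prod rmorph_prod; apply: ler_prod => i _.
by rewrite normr_ge0 phiP.
Qed.
Local Close Scope classical_set_scope.

(** * Level sets of the law of a walk *)

Hypothesis p_gt2 : (2 < p)%N.

Let p_gt0 : 0 < p%:R :> R.
Proof. by rewrite ltr0n prime_gt0. Qed.

(* When [w] is the characteristic function of a symmetric random walk on [F_p],
   [dlaw w x] is the probability that the walk is at [2 x]. *)
Definition dlaw (w : 'F_p -> R) (x : 'F_p) : R :=
  p%:R^-1 * \sum_xi w xi * cosp (xi * (x + x)).

(** With [w] the weight of [B] and [d = 1/32] this is the set [L] of the overview. *)
Definition level (w : 'F_p -> R) (d : R) : {set 'F_p} :=
  [set x | (1 - d) * dlaw w 0 <= dlaw w x]%SET.

Section Level.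
Variable w : 'F_p -> R.
Hypothesis w_ge0 : forall xi, 0 <= w xi.
Hypothesis w_le1 : forall xi, w xi <= 1.
Local Notation Q := (dlaw w).

Lemma dlaw0 : Q 0 = p%:R^-1 * \sum_xi w xi.
Proof.
by rewrite /dlaw; under eq_bigr do rewrite addr0 mulr0 cosp0 mulr1.
Qed.

Lemma dlawN x : Q (- x) = Q x.
Proof.
rewrite /dlaw; congr (_ * _); apply: eq_bigr => xi _.
by rewrite -opprD mulrN cospN.
Qed.

(** This is [cospD_ge] averaged with the non-negative weights [w xi]: the loss [Q 0 - Q x] behaves
    like a squared seminorm. *)
Lemma dlawD x y : Q 0 - Q (x + y) <= 2 * (Q 0 - Q x) + 2 * (Q 0 - Q y).
Proof.
rewrite dlaw0 /dlaw -!mulrBr -!sumrB !(mulrCA 2) -mulrDr.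
rewrite ler_pM2l ?invr_gt0 // !mulr_sumr -big_split /=.
apply: ler_sum => xi _; rewrite addrACA mulrDr.
have := cospD_ge (xi * (x + x)) (xi * (y + y)).
by move=> /(ler_wpM2l (w_ge0 xi)); lra.
Qed.

Lemma level_addP (d : R) x y :
  x \in level w d -> y \in level w d -> x + y \in level w (4 * d).
Proof. by rewrite !inE; have := dlawD x y; lra. Qed.

(** Parseval: [Q x] is [1/p] times the real part of the transform of [w] at [2 x], doubling is a
    bijection since [p] is odd, and [w ^ 2 <= w]. *)
Lemma sum_sqr_dlaw_le : \sum_x Q x ^+ 2 <= Q 0.
Proof.
pose Z (y : 'F_p) : R[i] := \sum_xi (w xi)%:C * chi (xi * y).
have ReZ y : complex.Re (Z y) = \sum_xi w xi * cosp (xi * y).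
  rewrite Re_sum; apply: eq_bigr => xi _; rewrite /cosp.
  by case: (chi _) => a b /=; rewrite mul0r subr0.
have two_neq0 : 2 != 0 :> 'F_p.
  by rewrite -(dvdn_pcharf (pchar_Fp p_prime)) gtnNdvd.
have dinj : injective (fun x : 'F_p => x + x).
  by move=> x y; rewrite -!mulr2n -(mulr_natl x) -(mulr_natl y); exact: mulfI.
have conjZ (a : R) (b : R[i]) : conjc (a%:C * b) = a%:C * conjc b.
    by rewrite -{2}(conjc_real a); exact: (rmorphM (@conjc R)).
  have parseval : \sum_y `|Z y| ^+ 2 = (p%:R * \sum_xi w xi ^+ 2)%:C.
  transitivity (\sum_y \sum_xi \sum_eta (w xi * w eta)%:C * chi (y * (xi - eta))).
    apply: eq_bigr => y _; rewrite sqr_normc /Z (rmorph_sum (@conjc R)) /=.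
    rewrite mulr_suml; apply: eq_bigr => xi _; rewrite mulr_sumr.
    apply: eq_bigr => eta _; rewrite conjZ.
    rewrite -chiN mulrACA -rmorphM -chiD /= mulrBr; congr (_ * chi _).
    by rewrite mulrC [eta * y]mulrC.
  rewrite exchange_big /= rmorphM rmorph_sum /= rmorph_nat mulr_sumr.
  apply: eq_bigr => xi _; rewrite exchange_big /= (bigD1 xi) //=.
  rewrite -mulr_sumr sum_chi subrr eqxx muln1 -expr2 [X in X + _]mulrC.
  rewrite big1 ?addr0 // => eta exi.
  by rewrite -mulr_sumr sum_chi subr_eq0 eq_sym (negPf exi) muln0 mulr0.
have hZ : \sum_y (\sum_xi w xi * cosp (xi * y)) ^+ 2 <= p%:R * \sum_xi w xi ^+ 2.
  rewrite -lecR -parseval rmorph_sum; apply: ler_sum => y _ /=.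
  by rewrite -add_Re2_Im2 ReZ lecR lerDl sqr_ge0.
have -> : \sum_x Q x ^+ 2 =
    p%:R^-1 ^+ 2 * \sum_y (\sum_xi w xi * cosp (xi * y)) ^+ 2.
  rewrite [in RHS](reindex_inj dinj) /= mulr_sumr; apply: eq_bigr => x _.
  by rewrite exprMn.
rewrite dlaw0; apply: le_trans (ler_wpM2l _ hZ) _.
  by rewrite exprn_ge0 ?invr_ge0 ?ltW.
rewrite mulrA expr2 mulfVK ?gt_eqF // ler_pM2l ?invr_gt0 //.
by apply: ler_sum => xi _; rewrite expr2 ler_piMl.
Qed.

(** Each [x] in the level set contributes at least [((1 - d) * Q 0) ^ 2] to a sum of squares that is
    at most [Q 0]. *)
Lemma card_level_le (d : R) : d <= 1 -> 0 < Q 0 ->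
  #|level w d|%:R * (1 - d) ^+ 2 * Q 0 <= 1.
Proof.
move=> d1 Q0; rewrite -(ler_pM2r Q0) mul1r.
apply: le_trans sum_sqr_dlaw_le.
apply: (@le_trans _ _ (\sum_(x in level w d) ((1 - d) * Q 0) ^+ 2)).
  rewrite sumr_const -[X in _ <= X]mulr_natl le_eqVlt.
  by apply/orP; left; apply/eqP; ring.
rewrite [X in _ <= X](bigID [in level w d]) /= ler_wpDr //.
  by apply: sumr_ge0 => x _; apply: sqr_ge0.
apply: ler_sum => x; rewrite inE => h.
by rewrite ler_sqr // nnegrE ?(le_trans _ h) // mulr_ge0 ?subr_ge0 // ltW.
Qed.

Lemma card_level_dlaw_le :
  2 < p%:R * Q 0 -> Q 0 <= 7 / 8 -> #|level w 32^-1|%:R * Q 0 <= 7 / 8.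
Proof.
move=> Qp Q78.
have Q0 : 0 < Q 0 by rewrite -(pmulr_rgt0 _ p_gt0); lra.
set T := level w 32^-1.
have h4 : #|level w (4 / 32)|%:R * (49 / 64) * Q 0 <= 1.
  have := @card_level_le (4 / 32) _ Q0; rewrite (_ : (1 - _) ^+ 2 = 49 / 64).
    by apply; lra.
  by field.
have sub : ([set x + y | x in T, y in T] \subset level w (4 / 32))%SET.
  by apply/fintype.subsetP => _ /imset2P[x y xT yT ->]; exact: level_addP.
have TN : {in T, forall x, - x \in T} by move=> x; rewrite !inE dlawN.
have T0 : 0 \in T by rewrite inE; nra.
have leT := subset_leq_card sub.
(* If [T] is [{0}], the bound is [Q 0 <= 7/8]. If [T + T] is everything, then
   [p * Q 0 <= 64/49 < 2], a contradiction. Otherwise [#|T| * Q 0 <= 2/3 * 64/49 = 128/147 <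
   7/8]. *)
have [->|ST|big3] := doubling_Fp p_prime TN T0.
- by rewrite cards1 mul1r.
- move: leT; rewrite ST cardsT card_Fp // => leT.
  have : p%:R <= #|level w (4 / 32)|%:R :> R by rewrite ler_nat.
  by move=> /(ler_wpM2r (ltW Q0)); lra.
- have : (3 * #|T| <= 2 * #|level w (4 / 32)|)%N.
    by rewrite (leq_trans big3) // leq_mul2l leT.
  rewrite -(ler_nat R) !natrM => /(ler_wpM2r (ltW Q0)); lra.
Qed.

End Level.

(** * The return probability *)

(* The characteristic function of the walk with steps [0] (probability 7/8)
   and [2] and [-2] (probability 1/16 each). *)
Definition psi (y : 'F_p) : R := 7 / 8 + cosp (y + y) / 8.

Lemma psi_ge0 y : 0 <= psi y.
Proof. by rewrite /psi; have := cosp_geN1 (y + y); lra. Qed.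

Lemma psi_le1 y : psi y <= 1.
Proof. by rewrite /psi; have := cosp_le1 (y + y); lra. Qed.

(** With [c = cosp y] the two sides are [|mu + (1 - mu) c|] and [(3 + c ^ 2) / 4]. The extreme cases
    are [mu = 1/2] from above and [mu = 0] from below, with gaps [(1 - c) ^ 2 / 4] and
    [(1 + c) (3 + c) / 4]. *)
Lemma lazy_char_le mu y : 0 <= mu <= 1 / 2 ->
  `|\sum_s (lazy_mass mu s)%:C * chi (y * lazy_value 'F_p s)| <= (psi y)%:C.
Proof.
move=> /andP[mu0 mu1].
rewrite (bigD1 None) //= mulr0 chi0 (bigD1 (Some true)) //=.
rewrite (bigD1 (Some false)) //= big1 ?addr0; last by case=> [[]|].
rewrite expr1 expr0 !mulr1 mulrN1 -mulrDr (addrC (chi _)) chi_add_chiN.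
rewrite -[X in X + _]/((mu)%:C) -rmorphM -rmorphD /=.
have -> (x : R) : `|x%:C| = `|x|%:C.
  by rewrite normc_def /= expr0n /= addr0 sqrtr_sqr.
rewrite lecR /psi cosp_double ler_norml.
have := cosp_le1 y; have := cosp_geN1 y.
by set c := cosp y => c1 c2; apply/andP; split; nra.
Qed.

Lemma sign_char_le y :
  `|\sum_(b : bool) (2^-1 : R)%:C * chi (y * (-1) ^+ b)| <= (psi y)%:C.
Proof.
have := @lazy_char_le 0 y; rewrite lexx divr_ge0 // => /(_ isT).
rewrite (bigD1 None) //= mul0r add0r (bigD1 (Some true)) //=.
rewrite (bigD1 (Some false)) //= big1 ?addr0; last by case=> [[]|].
by rewrite big_bool /= subr0 mul1r.
Qed.

Section Weight.
Variables (I : finType) (u : I -> 'F_p).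

(** The characteristic function of the walk that makes one very lazy step [2 u_j] for each [j] in
    [B]. *)
Definition weight (B : {set I}) (xi : 'F_p) : R := \prod_(j in B) psi (xi * u j).

Definition ret (B : {set I}) : R := p%:R^-1 * \sum_xi weight B xi.

Lemma weight_ge0 B xi : 0 <= weight B xi.
Proof. by apply: prodr_ge0 => j _; exact: psi_ge0. Qed.

Lemma weight_le1 B xi : weight B xi <= 1.
Proof.
by apply: prodr_ile1 => j _; rewrite psi_ge0 psi_le1.
Qed.

Lemma ret_dlaw B : ret B = dlaw (weight B) 0.
Proof. by rewrite dlaw0. Qed.

Lemma weight0 B : weight B 0 = 1.
Proof.
by rewrite /weight big1 // => j _; rewrite /psi mul0r addr0 cosp0 -mulrDl; field.
Qed.

(** Frequency 0 alone contributes [1/p]. *)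
Lemma ret_ge B : p%:R^-1 <= ret B.
Proof.
rewrite /ret ler_peMr ?invr_ge0 ?ler0n // (bigD1 0) //= weight0 lerDl.
by apply: sumr_ge0 => xi _; exact: weight_ge0.
Qed.

Lemma ret_gt0 B : 0 < ret B.
Proof. by apply: lt_le_trans (ret_ge B); rewrite invr_gt0. Qed.

Lemma ret_set0 : ret finset.set0 = 1.
Proof.
rewrite /ret (eq_bigr (fun=> 1)) => [|xi _]; last by rewrite /weight big_set0.
by rewrite sumr_const card_Fp // mulVf ?gt_eqF.
Qed.

Lemma ret_subset (A B : {set I}) : A \subset B -> ret B <= ret A.
Proof.
move=> AB; rewrite ler_pM2l ?invr_gt0 //; apply: ler_sum => xi _.
rewrite /weight (big_setID A) /= (finset.setIidPr AB) ler_piMr ?weight_ge0 //.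
by apply: prodr_ile1 => j _; rewrite psi_ge0 psi_le1.
Qed.

Lemma ret_le1 B : ret B <= 1.
Proof. by rewrite -ret_set0 ret_subset ?finset.sub0set. Qed.

(** Condition on the new step: it is 0 with probability 7/8; otherwise, by symmetry, the walk on [B]
    has to be at [2 u_i]. *)
Lemma retU1 (i : I) (B : {set I}) : i \notin B ->
  ret (i |: B) = 7 / 8 * ret B + dlaw (weight B) (u i) / 8.
Proof.
move=> iB; rewrite /ret /dlaw !(mulrCA _ p%:R^-1) -[X in _ + X]mulrA -mulrDr.
congr (_ * _); rewrite mulr_sumr mulr_suml -big_split /=.
apply: eq_bigr => xi _; rewrite {1}/weight big_setU1 //= -/(weight B xi) /psi.
by rewrite -mulrDr; ring.
Qed.

Lemma sum_cosp (x : 'F_p) : x != 0 -> \sum_xi cosp (xi * x) = 0.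
Proof.
by move=> /negPf x0; rewrite -Re_sum sum_chi x0 muln0.
Qed.

Lemma ret_set1 (i : I) : u i != 0 -> ret [set i] = 7 / 8.
Proof.
move=> ui0; rewrite -[[set i]]finset.setU0 retU1 ?inE // ret_set0 mulr1.
rewrite /dlaw (eq_bigr (fun xi => cosp (xi * (u i + u i)))) => [|xi _].
  rewrite sum_cosp ?mulr0 ?mul0r ?addr0 // -mulr2n -mulr_natl mulf_neq0 //.
  by rewrite -(dvdn_pcharf (pchar_Fp p_prime)) gtnNdvd.
by rewrite /weight big_set0 mul1r.
Qed.

(** The conditions serve, in this order, to bound [#|B|], to handle the level set [{0}], and to
    confine the coordinates outside [B]. *)
Definition basis (B : {set I}) : Prop :=
  [/\ ret B <= (255 / 256) ^+ #|B|, ret B <= 7 / 8 &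
      forall i, i \notin B -> u i \in level (weight B) 32^-1].

(* Take [B] of maximal size with [u] non-zero on [B] and
   [ret B <= (255 / 256) ^ #|B|]: if [u i] were not in the level set, then
   [i |: B] would satisfy the same bound. *)
Lemma basis_exists : (exists i, u i != 0) -> exists B, basis B.
Proof.
case=> i0 ui0.
pose P (B : {set I}) := (i0 \in B) && (ret B <= (255 / 256) ^+ #|B|).
have P0 : P [set i0].
  by rewrite /P set11 cards1 expr1 ret_set1 //; lra.
case: (@arg_maxnP _ [set i0] P (fun B => #|B|) P0) => B /andP[i0B leB] maxB.
exists B; split=> //.
  by rewrite -(ret_set1 ui0) ret_subset // finset.sub1set.
move=> i iB; rewrite inE leNgt; apply/negP => lt_i.
have /maxB : P (i |: B).
  rewrite /P inE i0B orbT cardsU1 iB exprS /= retU1 //.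
  (* The constant is [7/8 + (1 - 1/32) / 8 = 255/256]. *)
  apply: (@le_trans _ _ (255 / 256 * ret B)).
    by move: lt_i; rewrite -ret_dlaw; lra.
  by rewrite ler_wpM2l //; lra.
by rewrite cardsU1 iB /= add1n ltnn.
Qed.

Lemma card_level_ret_le B : basis B -> 2 < p%:R * ret B ->
  #|level (weight B) 32^-1|%:R * ret B <= 7 / 8.
Proof.
move=> [_ ? _]; rewrite ret_dlaw => ?.
apply: card_level_dlaw_le => //; last by rewrite -ret_dlaw.
- exact: weight_ge0.
- exact: weight_le1.
Qed.

End Weight.

(** Since [weight], and with it [ret] and [level], only sees [u] on [B], the union bound can fix
    this restriction first. *)
Lemma eq_weight (I : finType) (u u' : I -> 'F_p) (B : {set I}) :
  {in B, u =1 u'} -> weight u B =1 weight u' B.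
Proof. by move=> uu' xi; apply: eq_bigr => j jB; rewrite uu'. Qed.

Lemma eq_ret (I : finType) (u u' : I -> 'F_p) (B : {set I}) :
  {in B, u =1 u'} -> ret u B = ret u' B.
Proof.
by move=> /eq_weight uu'; rewrite /ret; under eq_bigr do rewrite uu'.
Qed.

Lemma eq_level (I : finType) (u u' : I -> 'F_p) (B : {set I}) d :
  {in B, u =1 u'} ->
  level (weight u B) d = level (weight u' B) d.
Proof.
move=> /eq_weight uu'; have /funext -> : weight u B =1 weight u' B by [].
by [].
Qed.

(** * Events bounded by return probabilities *)

Local Open Scope classical_set_scope.

(** Dividing by [g] over the integers before reducing keeps the coefficients [b] even when [p]
    divides [g]. If [g] does not divide [c], the event is empty and the rounded quotient is
    harmless. *)
Lemma atom_event_le n (mu : R) (g : int) (b : 'rV[int]_n) (c : int) :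
    0 <= mu <= 1 / 2 -> g != 0 ->
  iid_prob (lazy_mass mu) [set w : {ffun 'I_n -> option bool} |
     \sum_(i < n) (g *: b) 0 i * lazy_value int (w i) = c]
  <= ret (fun i => (b 0 i)%:~R) [set: 'I_n]%SET.
Proof.
move=> mu01 g0; pose u i : 'F_p := (b 0 i)%:~R.
have sub : [set w : {ffun 'I_n -> option bool} |
     \sum_(i < n) (g *: b) 0 i * lazy_value int (w i) = c] `<=`
   [set w | forall j : unit, \sum_i u i * lazy_value 'F_p (w i) = (c %/ g)%Z%:~R].
  move=> w /= <- _.
  rewrite (_ : \sum_(i < n) _ = (\sum_i b 0 i * lazy_value int (w i)) * g).
    rewrite mulzK // rmorph_sum; apply: eq_bigr => i _; rewrite rmorphM /=.
    by congr (_ * _); case: (w i) => [bb|] //=; rewrite rmorphXn rmorphN1.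
  by rewrite mulr_suml; apply: eq_bigr => i _; rewrite mxE -mulrA mulrC.
apply: le_trans (le_iid_prob _ sub) _.
  by case=> [bb|] /=; move: mu01 => /andP[]; lra.
apply: le_trans (prob_solutions_le (fun=> u) (fun=> _) (fun y => lazy_char_le y mu01)) _.
rewrite card_unit expr1 /ret ler_pM2l ?invr_gt0 //.
rewrite (reindex (fun x : 'F_p => [ffun _ : unit => x])) /=; last first.
  exists (fun f : {ffun unit -> 'F_p} => f tt) => [x _|f _]; first by rewrite ffunE.
  by apply/ffunP => -[]; rewrite ffunE.
apply: ler_sum => x _; rewrite le_eqVlt; apply/orP; left; apply/eqP.
rewrite /weight [RHS](eq_bigl xpredT) => [|i]; last by rewrite inE.
by apply: eq_bigr => i _; rewrite (bigD1 tt) //= big1 ?addr0 ?ffunE // => -[].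
Qed.

(* In the Fourier expansion of the event, the entries of the matrix in [S x B] are
   pairwise distinct and each of them involves a single frequency; the factors
   coming from all other entries are bounded by 1. *)
Lemma rows_prob_le n (u : 'I_n -> 'F_p) (B S : {set 'I_n}) :
    [disjoint S & B]%B ->
  iid_prob (fun _ : bool => 2^-1 : R) [set w : {ffun upper_index n -> bool} |
    forall i, i \in S -> \sum_j (-1) ^+ w (to_upper i j) * u j = 0]
  <= ret u B ^+ #|S|.
Proof.
move=> dSB.
pose J : finType := {i : 'I_n | i \in S}.
(* The coefficient of the independent entry [e] in the equation of row [j]. *)
pose c (j : J) (e : upper_index n) : 'F_p :=
  \sum_k u k * (to_upper (val j) k == e)%:R.
have sub : [set w : {ffun upper_index n -> bool} |
    forall i, i \in S -> \sum_j (-1) ^+ w (to_upper i j) * u j = 0] `<=`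
  [set w : {ffun upper_index n -> bool} | forall j : J,
     \sum_e c j e * (-1) ^+ w e = 0].
  move=> w /= h j; rewrite -[RHS](h _ (valP j)) /c.
  under eq_bigr do rewrite mulr_suml; rewrite exchange_big /=.
  apply: eq_bigr => k _; rewrite (bigD1 (to_upper (val j) k)) //= eqxx mulr1 mulrC.
  by rewrite big1 ?addr0 // => e /negPf ek; rewrite eq_sym ek mulr0 mul0r.
apply: le_trans (le_iid_prob _ sub) _; first by move=> s; rewrite invr_ge0.
apply: le_trans (prob_solutions_le c (fun=> 0) sign_char_le) _.
have cardJ : #|J| = #|S| by rewrite card_sig; apply: eq_card.
have -> : ret u B ^+ #|S| =
    p%:R^-1 ^+ #|J| * \sum_(xi : {ffun J -> 'F_p}) \prod_j weight u B (xi j).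
  rewrite -(bigA_distr_bigA (fun _ x => weight u B x)) /= prodr_const.
  by rewrite -exprMn -cardJ.
rewrite ler_wpM2l ?exprn_ge0 ?invr_ge0 ?ler0n //; apply: ler_sum => xi _.
pose h (jk : J * 'I_n) := to_upper (val jk.1) jk.2.
pose A : {set J * 'I_n} := [set jk | jk.2 \in B]%SET.
have neq (j : J) (k : 'I_n) : k \in B -> val j <> k.
  by move=> kB jk; have := disjointFr dSB (valP j); rewrite jk kB.
have h_inj : {in A &, injective h}.
  move=> [j k] [j' k']; rewrite !inE /h /= => kB k'B.
  by case/to_upper_eq => [[/val_inj -> ->] //|[/(neq _ _ k'B)]].
have coef j k : k \in B -> \sum_j' xi j' * c j' (to_upper (val j) k) = xi j * u k.
  move=> kB; rewrite (bigD1 j) //= [X in _ + X]big1 ?addr0 => [|j' /eqP j'j].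
    congr (_ * _); rewrite /c (bigD1 k) //= eqxx mulr1 big1 ?addr0 // => k' /eqP k'k.
    case: eqP; rewrite ?mulr0 // => /to_upper_eq[[_ //]|[/(neq _ _ kB) //]].
  rewrite /c big1 ?mulr0 // => k' _.
  case: eqP; rewrite ?mulr0 // => /to_upper_eq[[/val_inj //]|[/(neq _ _ kB) //]].
rewrite (bigID [in h @: A]%SET) /=.
apply: le_trans (_ : \prod_(e in (h @: A)%SET) psi (\sum_j xi j * c j e) <= _).
  rewrite ler_piMr //; first by apply: prodr_ge0 => e _; exact: psi_ge0.
  by apply: prodr_ile1 => e _; rewrite psi_ge0 psi_le1.
rewrite big_imset //= /weight pair_big_dep /= le_eqVlt; apply/orP; left; apply/eqP.
by apply: eq_big => [[j k]|[j k]]; rewrite inE //= => kB; rewrite /h /= coef.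
Qed.

Local Close Scope classical_set_scope.

(** * The union bound *)

Definition biased (I : finType) (u : I -> 'F_p) (B : {set I}) : Prop :=
  basis u B /\ 2 < p%:R * ret u B.

(** Each of the [p ^ #|B|] restrictions to [B] fixes [ret] and [L]. With one factor [ret] assigned
    to every coordinate outside [B], the sum over the rest of [u] splits into factors
    [#|L| * ret <= 7/8]. *)
Lemma sum_biased_le (I : finType) (B : {set I}) :
  \sum_(u : {ffun I -> 'F_p} | `[< biased u B >]) ret u B ^+ #|~: B|
  <= p%:R ^+ #|B| * (7 / 8) ^+ #|~: B|.
Proof.
pose r (u : {ffun I -> 'F_p}) := [ffun i => if i \in B then u i else 0].
rewrite (partition_big r (mem (pffun_on (0 : 'F_p) (mem B) (mem 'F_p)))) /=; last first.
  move=> u _; apply/pffun_onP; split=> //; apply/fintype.subsetP => i.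
  by rewrite inE ffunE; case: ifP; rewrite ?eqxx.
apply: (@le_trans _ _ (\sum_(z in pffun_on (0 : 'F_p) (mem B) (mem 'F_p))
                         (7 / 8 : R) ^+ #|~: B|)).
  2: rewrite sumr_const card_pffun_on -[X in X <= _]mulr_natl.
  2: by rewrite card_Fp ?natrX.
apply: ler_sum => z _.
(* An empty class contributes 0; otherwise any member [u0] gives the bound on [L]. *)
have [[u0 /andP[/asboolP[bu0 pu0] /eqP ru0]]|none] :=
  pselect (exists u : {ffun I -> 'F_p}, `[< biased u B >] && (r u == z)); last first.
  rewrite big_pred0 ?exprn_ge0 //; first by lra.
  by move=> u; apply/negbTE/negP => h; apply: none; exists u.
have zu u : r u = z -> {in B, u =1 z}.
  by move=> <- i iB; rewrite ffunE iB.
pose L := level (weight z B) 32^-1.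
have cL : #|L|%:R * ret z B <= 7 / 8.
  rewrite /L -(eq_level _ (zu _ ru0)) -(eq_ret (zu _ ru0)).
  exact: card_level_ret_le.
pose G i x := if i \in B then x == z i else x \in L.
pose g i : R := if i \in B then 1 else ret z B.
have g0 i : 0 <= g i by rewrite /g; case: ifP => // _; exact: ltW (ret_gt0 _ _).
have prod_if (c : R) : \prod_i (if i \in B then 1 else c) = c ^+ #|~: B|.
  rewrite (bigID [in B]) /= big1 ?mul1r => [|i ->//].
  rewrite -prodr_const; apply: eq_big => [i|i /negPf -> //].
  by rewrite inE.
apply: (@le_trans _ _ (\sum_(u in family G) \prod_i g i)).
  rewrite big_mkcond [X in _ <= X]big_mkcond; apply: ler_sum => u _ /=.
  case: ifPn => [/andP[/asboolP[[_ _ bu] _] /eqP ru]|_]; last first.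
    by case: ifP => // _; apply: prodr_ge0.
  rewrite ifT ?prod_if ?(eq_ret (zu _ ru)) //.
  apply/familyP => i; rewrite unfold_in /G.
  case: ifPn => iB; first by rewrite (zu _ ru).
  by rewrite /L -(eq_level _ (zu _ ru)); exact: bu.
rewrite -(bigA_distr_big_dep G (fun i _ => g i)) -prod_if.
apply: ler_prod => i _; rewrite sumr_ge0 //= /G /g.
case: ifP => _; first by rewrite big_pred1_eq.
rewrite sumr_const -[X in X <= _]mulr_natl; exact: cL.
Qed.

(** At most [k] elements of [~: B] are missing from [S :\: B]; each missing factor [ret] costs a
    factor [p], as [p * ret >= 1]. *)
Lemma rows_biased_le n k (B S : {set 'I_n}) : (#|~: S| <= k)%N ->
  \sum_(u : {ffun 'I_n -> 'F_p} | `[< biased u B >]) ret u B ^+ #|S :\: B|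
  <= p%:R ^+ (#|B| + k) * (7 / 8) ^+ (n - #|B|).
Proof.
move=> Sk; have cB : #|~: B| = (n - #|B|)%N by rewrite cardsCs finset.setCK card_ord.
rewrite exprD mulrAC -cB.
apply: le_trans (ler_wpM2r _ (sum_biased_le B)); last by rewrite exprn_ge0.
rewrite mulr_suml; apply: ler_sum => u _.
have le1 := ret_le1 u B; have gt0 := ret_gt0 u B.
apply: (@le_trans _ _ (ret u B ^+ (#|S :\: B| + k) * p%:R ^+ k)).
  rewrite exprD -mulrA -exprMn ler_peMr ?exprn_ge0 ?(ltW gt0) ?exprn_ege1 //.
  by have := ret_ge u B; rewrite -(ler_pM2r p_gt0) mulVf ?gt_eqF.
rewrite ler_wpM2r ?exprn_ge0 ?ler_wiXn2l ?(ltW gt0) //.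
have -> : ~: B = (S :\: B) :|: (~: S :\: B).
  by rewrite -finset.setDUl finset.setUCr finset.setTD.
rewrite (leq_trans (leq_card_setU _ _)) // leq_add2l.
by apply: leq_trans Sk; rewrite subset_leq_card // finset.subsetDl.
Qed.

(** There are at most [n.+1 ^ (k + b)] pairs [(S, B)]. The rows in [B] are given up, so that those
    used are disjoint from [B]. *)
Lemma sign_rows_union_le n k b :
    (forall (u : 'I_n -> 'F_p) B, basis u B -> (#|B| <= b)%N) ->
  iid_prob (fun _ : bool => 2^-1 : R)
    [set w : {ffun upper_index n -> bool} |
      exists (u : {ffun 'I_n -> 'F_p}) (S : {set 'I_n}),
      [/\ exists i, u i != 0, (#|~: S| <= k)%N,
          2 < p%:R * ret u [set: 'I_n]%SET &
          forall i, i \in S -> \sum_j (-1) ^+ w (to_upper i j) * u j = 0]]%classic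
  <= n.+1%:R ^+ (k + b) * p%:R ^+ (b + k) * (7 / 8) ^+ (n - b).
Proof.
move=> basis_le.
pose X : finType := ({set 'I_n} * {set 'I_n} * {ffun 'I_n -> 'F_p})%type.
pose P (SB : {set 'I_n} * {set 'I_n}) := (#|~: SB.1| <= k)%N && (#|SB.2| <= b)%N.
pose Q (x : X) := P x.1 && `[< biased x.2 x.1.2 >].
pose F (x : X) := [set w : {ffun upper_index n -> bool} |
  forall i, i \in x.1.1 :\: x.1.2 ->
    \sum_j (-1) ^+ w (to_upper i j) * x.2 j = 0]%classic.
apply: le_trans (@iid_prob_union_bound _ _ _ X _ Q _ F _ _) _.
- by move=> s; rewrite invr_ge0.
- move=> w [u [S [u0 Sk pu uw]]].
  have [B uB] := basis_exists u0.
  exists (S, B, u); last by move=> i /=; rewrite inE => /andP[_ /uw].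
  apply/andP; split; first by apply/andP; split=> //; exact: basis_le uB.
  (* Fewer steps only raise [ret], so the lower bound passes from all coordinates to [B]. *)
  apply/asboolP; split=> //; apply: lt_le_trans pu _.
  by rewrite ler_pM2l // ret_subset // finset.subsetT.
apply: (@le_trans _ _ (\sum_(x | Q x) ret x.2 x.1.2 ^+ #|x.1.1 :\: x.1.2|)).
  apply: ler_sum => -[[S B] u] _; apply: rows_prob_le.
  by rewrite -finset.setI_eq0 finset.setIDAC finset.setDIl finset.setDv finset.setI0.
rewrite -(pair_big_dep P (fun SB (u : {ffun 'I_n -> 'F_p}) => `[< biased u SB.2 >])
  (fun SB u => ret u SB.2 ^+ #|SB.1 :\: SB.2|)) /=.
apply: (@le_trans _ _ (\sum_(SB | P SB) p%:R ^+ (b + k) * (7 / 8) ^+ (n - b))).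
  apply: ler_sum => -[S B] /andP[/= Sk Bb].
  apply: le_trans (rows_biased_le B Sk) _.
  apply: ler_pM; rewrite ?exprn_ge0 ?divr_ge0 ?ler0n //.
    by rewrite ler_weXn2l ?ler1n ?prime_gt0 // leq_add2r.
  by rewrite ler_wiXn2l ?leq_sub2l //; lra.
rewrite sumr_const -[X in X <= _]mulr_natl -mulrA.
apply: ler_wpM2r; first by rewrite mulr_ge0 ?exprn_ge0 ?divr_ge0 ?ler0n.
rewrite -natrX ler_nat expnD.
pose X1 := [set S : {set 'I_n} | (#|~: S| <= k)%N]%SET.
pose X2 := [set B : {set 'I_n} | (#|B| <= b)%N]%SET.
have -> : #|P| = #|finset.setX X1 X2|.
  by apply: eq_card => -[S B]; rewrite [in RHS]inE /= !inE.
have := card_small_sets 'I_n; rewrite card_ord => csmall.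
rewrite cardsX leq_mul ?csmall //.
rewrite -(card_imset _ (@finset.setC_inj _)); apply: leq_trans (csmall k).
by apply/subset_leq_card/fintype.subsetP => _ /imsetP[S + ->]; rewrite !inE.
Qed.

End Fourier.

(** * Reduction modulo a prime *)

Lemma intr_Fp_eq0 p (x : int) : prime p -> (x%:~R == 0 :> 'F_p) = (p %| x)%Z.
Proof.
move=> p_prime; rewrite {1}[x]intEsign rmorphM rmorph_sign /=.
rewrite mulf_eq0 signr_eq0 /= -(dvdn_pcharf (pchar_Fp p_prime)).
by rewrite dvdzE.
Qed.

(** Descent: while [p] divides all entries, divide by [p]; the absolute value of a fixed non-zero
    entry drops. *)
Lemma int_row_primitive p n (a : 'rV[int]_n) : prime p -> a != 0 ->
  exists g b, [/\ a = g *: b, g != 0 & exists i, (b 0 i)%:~R != 0 :> 'F_p].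
Proof.
move=> p_prime; have p0 : p%:Z != 0 by rewrite -lt0n prime_gt0.
case/rV0Pn => j0 aj0; have [m] := ubnP (absz (a 0 j0)).
elim: m a aj0 => // m IH a aj0 am.
have [/existsP[i ai]|] := boolP [exists i, (a 0 i)%:~R != 0 :> 'F_p].
  by exists 1, a; rewrite scale1r oner_eq0; split=> //; exists i.
rewrite negb_exists => /forallP all0.
pose a' : 'rV[int]_n := \row_i divz (a 0 i) p.
have aE : a = p%:Z *: a'.
  apply/rowP => i; rewrite !mxE mulrC divzK //.
  by rewrite -intr_Fp_eq0 //; have := all0 i; rewrite negbK.
have a'j0 : a' 0 j0 != 0.
  by apply: contraNneq aj0 => e; rewrite aE mxE e mulr0.
have [|g [b [a'E g0 bi]]] := IH a' a'j0.
  move: am; rewrite aE mxE abszM ltnS; apply: leq_trans.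
  by rewrite ltn_Pmull ?prime_gt1 // absz_gt0.
by exists (p%:Z * g), b; rewrite -scalerA -a'E mulf_neq0.
Qed.

(** For a violating [a = g *: b], take [u] as [b] modulo [p] and [S] as the rows orthogonal to [a];
    an atom of mass above [alpha >= 2/p] forces [ret > 2/p]. *)
Lemma not_Orth_biased (R : realType) p (p_prime : prime p) n k (alpha beta : R)
    (w : {ffun upper_index n -> bool}) :
    (2 < p)%N -> 2 / p%:R <= alpha -> beta * n%:R <= k%:R ->
    (~` Orth n alpha beta)%classic (sym_sign_mx w) ->
  exists (u : {ffun 'I_n -> 'F_p}) (S : {set 'I_n}),
    [/\ exists i, u i != 0, (#|~: S| <= k)%N,
        2 < p%:R * ret R p_prime u [set: 'I_n]%SET &
        forall i, i \in S -> \sum_j (-1) ^+ w (to_upper i j) * u j = 0].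
Proof.
move=> p_gt2 alpha_ge beta_le nOrth.
have p_gt0 : 0 < p%:R :> R by rewrite ltr0n prime_gt0.
apply: contra_notP nOrth => none a a0 card_ge mu mu01.
rewrite /atom_prob; apply: ge_sup; first by exists (iid_prob (lazy_mass mu)
      [set w : {ffun 'I_n -> option bool} |
        \sum_(i < n) a 0 i * lazy_value int (w i) = 0]%classic), 0.
move=> _ [c _ <-]; rewrite leNgt; apply/negP => gt_alpha; apply: none.
have [g [b [aE g0 [i bi]]]] := int_row_primitive p_prime a0.
exists [ffun i => (b 0 i)%:~R], [set i | row i (sym_sign_mx w) *m a^T == 0]%SET.
split.
- by exists i; rewrite ffunE.
- rewrite -(ler_nat R); apply: le_trans beta_le.
  have := cardsC [set i | row i (sym_sign_mx w) *m a^T == 0]%SET.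
  rewrite card_ord => /(congr1 (fun m => m%:R : R)); rewrite natrD.
  move: card_ge; rewrite mulrBl mul1r cardsE.
  set x := (#|_|%:R : R); set y := (#|_|%:R : R) => h1 h2.
  by rewrite -h2 in h1 *; lra.
- rewrite -ltr_pdivrMl // mulrC (le_lt_trans alpha_ge) //.
  apply: lt_le_trans gt_alpha _; rewrite aE.
  have := @atom_event_le R p p_prime n mu g b c mu01 g0.
  move/le_trans; apply.
  by rewrite le_eqVlt; apply/orP; left; apply/eqP/eq_ret => j _; rewrite ffunE.
- move=> j; rewrite inE => /eqP/matrixP/(_ 0 0); rewrite !mxE aE.
  rewrite (_ : \sum_j0 _ = g * \sum_j0 sym_sign_mx w j j0 * b 0 j0); last first.
    by rewrite mulr_sumr; apply: eq_bigr => l _; rewrite !mxE mulrCA.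
  move/eqP; rewrite mulf_eq0 (negPf g0) /= => /eqP/(congr1 (fun x : int => x%:~R : 'F_p)).
  rewrite rmorph_sum mulr0z => sum0; rewrite -[RHS]sum0; apply: eq_bigr => l _.
  by rewrite ffunE rmorphM /= mxE rmorphXn rmorphN1.
Qed.

(** * Numerical estimates *)

Lemma bernoulli (R : realFieldType) (x : R) m : 0 <= x -> 1 + x *+ m <= (1 + x) ^+ m.
Proof.
move=> x0; elim: m => [|m IH]; first by rewrite mulr0n addr0 expr0.
rewrite exprS; apply: le_trans (ler_wpM2l _ IH); last by rewrite addr_ge0.
have := mulrn_wge0 m x0; rewrite mulrS; nra.
Qed.

(** Compare [1/p <= ret <= (255/256) ^ #|B|] with [(255/256) ^ 256 <= 1/2]. *)
Lemma card_basis_le (R : realType) p (p_prime : prime p) (I : finType)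
    (u : I -> 'F_p) (B : {set I}) m :
  (p <= 2 ^ m)%N -> basis R p_prime u B -> (#|B| <= 256 * m)%N.
Proof.
move=> pm [retB _ _]; rewrite leqNgt; apply/negP => Bm.
have p_gt0 : 0 < p%:R :> R by rewrite ltr0n prime_gt0.
have half : (255 / 256 : R) ^+ 256 <= 2^-1.
  have b2 : 2 <= (256 / 255 : R) ^+ 256.
    have x0 : 0 <= 255^-1 :> R by rewrite invr_ge0.
    have := bernoulli 256 x0; rewrite -[_ *+ _]mulr_natl.
    rewrite (_ : 1 + 255^-1 = 256 / 255 :> R); last by field.
    by apply: le_trans; lra.
  rewrite (_ : 255 / 256 = (256 / 255)^-1 :> R); last by field.
  by rewrite exprVn lef_pV2 ?posrE ?(lt_le_trans _ b2).
have le1 : (255 / 256 : R) ^+ #|B| <= (255 / 256) ^+ (256 * m).+1.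
  by rewrite ler_wiXn2l //; lra.
have le2 : (255 / 256 : R) ^+ (256 * m).+1 < (2^-1) ^+ m.
  rewrite exprS; apply: (@lt_le_trans _ _ ((255 / 256) ^+ (256 * m))).
    by rewrite gtr_pMl ?exprn_gt0 //; lra.
  by rewrite exprM lerXn2r ?nnegrE ?exprn_ge0 //; lra.
have := ret_ge R p_prime u B.
rewrite leNgt => /negP; apply; apply: le_lt_trans (le_trans retB le1) _.
apply: lt_le_trans le2 _.
by rewrite exprVn lef_pV2 ?posrE ?exprn_gt0 // -natrX ler_nat.
Qed.

(** With [y = n ^ (1/12)], [ln n = 6 ln (y ^ 2) <= 9 y ^ 2], so the product is at most [3 y ^ 4 = 3
    n ^ (1/3) <= 3 (k + 1) <= 6 k]. *)
Lemma powR_ln_le (R : realType) n k : (0 < k)%N -> (0 < n < k.+1 ^ 3)%N ->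
  n%:R `^ (1 / 4) * Num.sqrt (ln n%:R) <= 6 * k%:R :> R.
Proof.
move=> k0 /andP[n0 nk].
have nR : 0 < n%:R :> R by rewrite ltr0n.
pose y : R := n%:R `^ (1 / 12).
have y0 : 0 < y by rewrite powR_gt0.
have ln_le : ln n%:R <= 9 * y ^+ 2.
  have -> : n%:R = (y ^+ 2) `^ 6 :> R.
    by rewrite -powR_mulrn ?(ltW y0) // -!powRrM (_ : _ * _ = 1) ?powRr1 ?ltW //; field.
  rewrite ln_powR; have := @ln_sublinear R (y ^+ 2) (exprn_gt0 _ y0); nra.
have sqrt_le : Num.sqrt (ln n%:R) <= 3 * y.
  rewrite -[3 * y]ger0_norm ?mulr_ge0 ?(ltW y0) // -sqrtr_sqr ler_wsqrtr //.
  by rewrite exprMn (_ : 3 ^+ 2 = 9) // -natrX.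
have y4 : y ^+ 4 <= k%:R + 1.
  rewrite -powR_mulrn ?(ltW y0) // -powRrM (_ : 1 / 12 * 4 = 3^-1); last by field.
  have -> : k%:R + 1 = ((k.+1 ^ 3)%N%:R) `^ 3^-1 :> R.
    by rewrite natrX -powR_mulrn // -powRrM divff ?powRr1 ?natr1 ?pnatr_eq0.
  by rewrite ge0_ler_powR ?nnegrE ?invr_ge0 // ler_nat ltnW.
have -> : n%:R `^ (1 / 4) = y ^+ 3 :> R.
  by rewrite -powR_mulrn ?(ltW y0) // -powRrM; congr powR; field.
apply: (@le_trans _ _ (y ^+ 3 * (3 * y))).
  by rewrite ler_wpM2l ?exprn_ge0 ?(ltW y0).
have k1 : 1 <= k%:R :> R by rewrite ler1n.
by rewrite mulrCA -exprSr; lra.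
Qed.

Lemma alpha_ge (R : realType) n k : (0 < k)%N -> (0 < n < k.+1 ^ 3)%N ->
  (2 ^+ k)^-1 <= alpha_ R n.
Proof.
move=> k0 nk; rewrite /alpha_ powRN lef_pV2 ?posrE ?powR_gt0 ?exprn_gt0 //.
rewrite -powR_mulrn // ler_powR ?ler1n //.
have := @powR_ln_le R n k k0 nk; have : 0 <= k%:R :> R by []. lra.
Qed.

(** As [n ^ (-3/4) * n = n ^ (1/4)], the estimate behind [alpha_ge] applies again. *)
Lemma beta_le (R : realType) n k : (0 < k)%N -> (0 < n < k.+1 ^ 3)%N ->
  beta_ R n * n%:R <= k%:R.
Proof.
move=> k0 nk; have := @powR_ln_le R n k k0 nk.
have -> : n%:R `^ (1 / 4) = n%:R `^ (- (3 / 4)) * n%:R :> R.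
  have n0 : (0 < n)%N by case/andP: nk.
  rewrite -{3}[n%:R]powRr1 // -powRD; last by rewrite pnatr_eq0 -lt0n n0 implybT.
  by congr powR; field.
by rewrite /beta_; have : 0 <= k%:R :> R by []; lra.
Qed.

Lemma cube_root_exists n : exists k, (k ^ 3 <= n < k.+1 ^ 3)%N.
Proof.
elim: n => [|n [k /andP[kn nk]]]; first by exists 0%N.
have [lt|ge] := ltnP n.+1 (k.+1 ^ 3); first by exists k; rewrite lt leqW.
by exists k.+1; rewrite ge (leq_ltn_trans nk) // ltn_exp2r.
Qed.

(** The first two factors are [2 ^ O(k ^ 2)], by [n + 1 <= 2 ^ (3 k)] and [p <= 2 ^ (2 k + 5)]; the
    last is about [2 ^ (- n / 6)], by [(7/8) ^ 6 <= 1/2], and [n >= k ^ 3] dominates. *)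
Lemma union_bound_small (R : realType) n k p b :
    160 * 160 <= k%:R :> R -> (k ^ 3 <= n < k.+1 ^ 3)%N ->
    (p <= 2 ^ (2 * k + 5))%N -> b = (256 * (2 * k + 5))%N ->
  n.+1%:R ^+ (k + b) * p%:R ^+ (b + k) * (7 / 8) ^+ (n - b)
  <= 2 `^ (- (n%:R / 32)) :> R.
Proof.
move=> kbig /andP[kn nk] pk bE.
set q := ((n - b) %/ 6)%N.
have h1 : (n.+1 <= 2 ^ (3 * k))%N.
  by apply: leq_trans nk _; rewrite mulnC expnM leq_exp2r // ltn_expl.
have h2 : (n.+1 ^ (k + b) * p ^ (b + k) <= 2 ^ ((5 * k + 5) * (k + b)))%N.
  rewrite [(b + k)%N]addnC -expnMn expnM leq_exp2r; last first.
    by rewrite bE; lia.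
  rewrite (_ : (5 * k + 5 = 3 * k + (2 * k + 5))%N); last by lia.
  by rewrite expnD leq_mul.
have h3 : (7 / 8 : R) ^+ (n - b) <= 2^-1 ^+ q.
  apply: (@le_trans _ _ ((7 / 8) ^+ (6 * q))).
    by rewrite ler_wiXn2l ?(mulnC 6) ?leq_trunc_div //; lra.
  by rewrite exprM lerXn2r ?nnegrE ?exprn_ge0 //; lra.
apply: (@le_trans _ _ (2 ^+ ((5 * k + 5) * (k + b)) * 2^-1 ^+ q)).
  apply: ler_pM => //; first by rewrite mulr_ge0 ?exprn_ge0.
    by rewrite exprn_ge0 //; lra.
  by rewrite -!natrX -natrM ler_nat.
rewrite exprVn -!powR_mulrn // -powRN -powRD; last by rewrite pnatr_eq0 implybT.
rewrite ler_powR ?ler1n //.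
have hq : n%:R <= b%:R + 6 * q%:R + 6 :> R.
  by rewrite -!natrM -!natrD ler_nat /q; lia.
have hn : k%:R ^+ 3 <= n%:R :> R by rewrite -natrX ler_nat.
move: hq; rewrite bE !(natrM, natrD).
set K := k%:R in kbig hn *; set Q := q%:R; set N := n%:R in hn *.
(* The leading loss [5 * 513 k ^ 2 = 2565 k ^ 2] is beaten by
   [(1/6 - 1/32) n >= 13/96 * 25600 k ^ 2]. *)
have : 160 * 160 * (K * K) <= N.
  apply: le_trans hn; rewrite !exprS expr0 mulr1 ler_wpM2r // mulr_ge0 //; lra.
have : 160 * 160 * K <= K * K by rewrite ler_wpM2r //; lra.
nra.
Qed.

(** * Choice of the parameters *)

Local Open Scope classical_set_scope.

Theorem theorem3p2 (R : realType) :
  exists N : nat, forall n : nat, (N <= n)%N ->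
    prob_sym_sign_mx R (~` Orth n (alpha_ R n) (beta_ R n))
      <= 2 `^ (- (n%:R / 32)).
Proof.
have [K Kbig] : exists K : nat, 160 * 160 <= K%:R :> R.
  by exists (Num.bound (160 * 160 : R)); rewrite ltW // archi_boundP // mulr_ge0.
have K0 : (0 < K)%N.
  by rewrite -(ltr0n R); apply: lt_le_trans Kbig; rewrite mulr_gt0.
exists (K ^ 3)%N => n Kn.
have [k /andP[kn nk]] := cube_root_exists n.
have Kk : (K <= k)%N by rewrite -ltnS -(ltn_exp2r _ _ (ltn0Sn 2)) (leq_ltn_trans Kn).
have k0 : (0 < k)%N by apply: leq_trans Kk.
have kbig : 160 * 160 <= k%:R :> R by apply: le_trans Kbig _; rewrite ler_nat.
have nk' : (0 < n < k.+1 ^ 3)%N by rewrite nk andbT (leq_trans _ kn) // expn_gt0 k0.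
(* Here [p > 2 ^ (k + 2)] ensures [2 / p <= 2 ^ (- k) <= alpha], and [p <= 2 ^ (2 k + 5)] keeps
   [log p] of order [n ^ (1/3)]. *)
have [|p p_prime /andP[kp pk]] := @prime_between k.+2; first by [].
have p_gt2 : (2 < p)%N by apply: leq_ltn_trans kp; rewrite -{1}(expn1 2) leq_exp2l.
have pk' : (p <= 2 ^ (2 * k + 5))%N.
  by rewrite (leq_trans pk) // leq_exp2l // -mul2n; lia.
apply: le_trans (union_bound_small kbig _ pk' erefl); last by rewrite kn.
apply: le_trans (@sign_rows_union_le R p p_prime p_gt2 n k _ _); last first.
  by move=> u B; exact: card_basis_le.
apply: le_iid_prob => [s|w]; first by rewrite invr_ge0.
apply: not_Orth_biased => //; last exact: beta_le.
apply: le_trans _ (alpha_ge R k0 nk').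
rewrite ler_pdivrMr ?ltr0n ?prime_gt0 // mulrC ler_pdivlMr ?exprn_gt0 //.
rewrite -natrX -natrM ler_nat; apply: leq_trans (ltnW kp).
by rewrite !expnS; lia.
Qed.
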